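(* Let $p$ be a prime, let $n,R\geq 1$ be integers and let $d$ be a positive integer with $d<p$. Let $A=(a_{ij})_{1\leq i\leq R,\,1\leq j\leq n}$ be an $R\times n$ matrix over $\mathbb{F}_p$, and let $P=(P_1,\ldots,P_R)$ be the diagonal polynomial map $P_i(x)=\sum_{j=1}^n a_{ij}x_j^d$. If $A$ is non-degenerate, then $\dim S_P^*\leq n/2$.
   Context: An $R\times n$ matrix $A$ is called non-degenerate if $\operatorname{rank}A'=R$ for every submatrix $A'$ of $A$ formed by all $R$ rows and by $\lceil n/2\rceil$ of the columns of $A$. $S_P^*=\{x:\operatorname{rank}(Jac_P(x))<R\}$, where $Jac_P(x)$ is the $R\times n$ matrix with entries $\partial_{x_j}P_i(x)$. It is regarded as an algebraic subset of $\bar{\mathbb{F}}_p^n$, where $\bar{\mathbb{F}}_p$ is the algebraic closure of $\mathbb{F}_p$, and its dimension is computed over $\bar{\mathbb{F}}_p$. *)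

(* Defs.v *)
From mathcomp Require Import all_boot all_order all_algebra all_field.
(* mpoly has to be loaded first: its notations do not parse after those of
   classical_sets and constructive_ereal have been declared. *)
From mathcomp Require Import mpoly.
From mathcomp Require Import boolp classical_sets constructive_ereal.

Set Implicit Arguments.
Unset Strict Implicit.
Unset Printing Implicit Defensive.

Import Order.TTheory GRing.Theory Num.Theory.
Local Open Scope classical_set_scope.
Local Open Scope ring_scope.

Section AffineSpace.
Variables (K : fieldType) (n : nat).

Definition evalp (f : {mpoly K[n]}) (x : 'rV[K]_n) : K :=
  f.@[fun i => x ord0 i].

Definition zero_locus (I : set {mpoly K[n]}) : set 'rV[K]_n :=
  [set x | forall f, I f -> evalp f x = 0].

Definition algebraic_set (Z : set 'rV[K]_n) : Prop :=
  exists I, Z = zero_locus I.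

Definition irreducible_set (Z : set 'rV[K]_n) : Prop :=
  [/\ algebraic_set Z, Z !=set0 &
      forall Z1 Z2, algebraic_set Z1 -> algebraic_set Z2 ->
        Z `<=` Z1 `|` Z2 -> Z `<=` Z1 \/ Z `<=` Z2].

(* Chains Z 0 < ... < Z m of irreducible algebraic subsets of S; the values of
   Z beyond m are irrelevant. *)
Definition irreducible_chain (S : set 'rV[K]_n) (m : nat) : Prop :=
  exists Z : nat -> set 'rV[K]_n,
    (forall i, (i <= m)%N -> irreducible_set (Z i) /\ Z i `<=` S) /\
    (forall i, (i < m)%N -> Z i `<` Z i.+1).

(* Krull dimension of an algebraic set S (over an algebraically closed K), as
   an extended rational so that it can be compared with n / 2. The supremum
   always exists (krull_dimP), and the empty set has dimension -oo. *)
Definition krull_dim (S : set 'rV[K]_n) : \bar rat :=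
  supremum -oo%E ((fun m : nat => m%:R%:E) @` irreducible_chain S).

End AffineSpace.

Section DimSup.
Local Open Scope ereal_scope.

Lemma has_supremum_natE (A : set nat) :
  supremums ((fun m : nat => m%:R%:E : \bar rat) @` A)%classic !=set0.
Proof.
have [A0|/set0P[a Aa]] := eqVneq A set0.
  exists -oo; split; last by move=> y _; exact: leNye.
  by move=> _ [m Am <-]; move: Am; rewrite A0.
have [[b bA]|nb] := pselect (exists b, forall m, A m -> (m <= b)%N).
  have ex : exists m, `[< A m >] by exists a; apply/asboolP.
  have ub : forall m, `[< A m >] -> (m <= b)%N by move=> m /asboolP; exact: bA.
  case: (ex_maxnP ex ub) => M /asboolP AM Mub.
  exists M%:R%:E; split=> [_ [m Am <-]|y]; last by apply; exists M.
  by rewrite lee_fin ler_nat; apply/Mub/asboolP.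
exists +oo; split=> [y _|y yub]; first exact: leey.
have Ab b : exists2 m, A m & (b < m)%N.
  apply: contrapT => h; apply: nb; exists b => m Am.
  by rewrite leqNgt; apply/negP => bm; apply: h; exists m.
case: y yub => [q|//|] yub.
- have [m Am qm] := Ab (Num.bound q).
  have := yub _ (ex_intro2 _ _ m Am erefl).
  rewrite lee_fin leNgt => /negP[].
  apply: le_lt_trans (ler_norm q) _.
  apply: lt_le_trans (archi_boundP (normr_ge0 q)) _.
  rewrite ler_nat; apply: leq_trans (ltnW qm).
  by rewrite /Num.bound normr_id.
- by have := yub _ (ex_intro2 _ _ a Aa erefl).
Qed.

Lemma krull_dimP (K : fieldType) (n : nat) (S : set 'rV[K]_n) (y : \bar rat) :
  krull_dim S <= y <-> (forall m, irreducible_chain S m -> m%:R%:E <= y).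
Proof.
rewrite /krull_dim /supremum; case: eqP => [E0|_].
  split=> [_ m cm|_]; last exact: leNye.
  have : ((fun m : nat => m%:R%:E : \bar rat) @` irreducible_chain S)%classic
    m%:R%:E by exists m.
  by rewrite E0.
have [x xs] := has_supremum_natE (irreducible_chain S).
have [ub least] := xgetPex -oo (ex_intro _ x xs).
split=> [le m cm|h]; first by apply: le_trans le; apply: ub; exists m.
by apply: least => _ [m cm <-]; exact: h.
Qed.

End DimSup.

Definition non_degenerate (F : fieldType) (R n : nat) (A : 'M[F]_(R, n)) : Prop :=
  forall J : {set 'I_n}, #|J| = uphalf n ->
    \rank (colsub (enum_val : 'I_#|J| -> 'I_n) A) = R.

Definition diagonal_map (F : fieldType) (R n : nat) (A : 'M[F]_(R, n))
    (d : nat) : 'I_R -> {mpoly F[n]} :=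
  fun i => \sum_(j < n) A i j *: 'X_j ^+ d.

Definition Jac (F : fieldType) (R n : nat) (P : 'I_R -> {mpoly F[n]}) :
    'M[{mpoly F[n]}]_(R, n) :=
  \matrix_(i < R, j < n) (P i)^`M(j).

(* S_P^*, as a subset of K^n for a field extension iota : F -> K. *)
Definition Sstar (F K : fieldType) (iota : {rmorphism F -> K}) (R n : nat)
    (P : 'I_R -> {mpoly F[n]}) : set 'rV[K]_n :=
  [set x | (\rank (map_mx (fun f => evalp (map_mpoly iota f) x) (Jac P)) < R)%N].

(* Main.v *)
Require Import Defs.
From mathcomp Require Import all_boot all_order all_algebra all_field.
From mathcomp Require Import mpoly.
From mathcomp Require Import boolp classical_sets constructive_ereal.

Import Order.TTheory GRing.Theory Num.Theory.
Local Open Scope ring_scope.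

(* A point x with at least n / 2 (rounded up) nonzero coordinates is not in
   S_P^*: the columns of the Jacobian at those coordinates are nonzero multiples
   of the columns of A. An irreducible Z contained in S_P^* meets the locus
   where none of the coordinates that do not vanish identically on Z is zero,
   so it lies in a coordinate subspace of dimension at most (n - 1) / 2.
   The length of a chain Z 0 < ... < Z m inside a coordinate subspace with r
   coordinates is at most r: choosing f i that vanishes on Z i but not on Z i.+1
   gives m algebraically independent functions on Z m, hence m algebraically
   independent polynomials in r variables. *)

(** * Polynomials: the last variable and algebraic dependence *)

(** A monomial is determined by its last exponent and its restriction to the other variables, so
    each coefficient of [p] can be read off [muni p]. *)
Lemma muni0_eq0 {n} {R : comNzRingType} (p : {mpoly R[n.+1]}) :
  muni p = 0 -> p = 0.
Proof.
move=> p0; apply/mpolyP => m; rewrite mcoeff0.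
have : ((muni p)`_(m ord_max))@_[multinom m (widen_ord (leqnSn n) i) | i < n]
       = 0 by rewrite p0 coef0 mcoeff0.
rewrite muniE coef_sum raddf_sum /= => <-.
rewrite [in LHS](mpolyE p) raddf_sum /=; apply: eq_bigr => m' _.
rewrite mcoeffZ mcoeffX coefZ coefXn mulr_natr.
have [->|mm] := eqVneq m' m; first by rewrite eqxx mcoeffZ mcoeffX eqxx.
rewrite mulr0; case: eqP => [e|_]; last by rewrite mcoeff0.
rewrite mulr1n mcoeffZ mcoeffX; case: eqP => [/mnmP E|]; last by rewrite mulr0.
case/eqP: mm; apply/mnmP => i.
have [j ->|->] := unliftP ord_max i; last by [].
have := E j; rewrite !mnmE.
suff -> : widen_ord (leqnSn n) j = lift ord_max j by [].
by apply: val_inj; rewrite /= /bump leqNgt ltn_ord.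
Qed.

Lemma meval_muni {n} {R : comNzRingType} (p : {mpoly R[n.+1]})
    (v : 'I_n.+1 -> R) :
  p.@[v] =
  (map_poly (meval (fun i => v (widen_ord (leqnSn n) i))) (muni p)).[v ord_max].
Proof.
rewrite muniE mevalE raddf_sum horner_sum; apply: eq_bigr => m _ /=.
rewrite map_polyZ /= map_polyXn hornerZ hornerXn mevalZ mevalX -mulrA.

rewrite big_ord_recr /=; congr (_ * (_ * _)).
by apply: eq_bigr => i _; rewrite mnmE.
Qed.

(** [(msize _).-1] is the degree, taken as 0 for the zero polynomial; only a zero factor can make
    the bound strict. *)
Lemma msize_prod_pred_leq {n} {K : idomainType} {I : Type} (r : seq I)
    (P : pred I) (q : I -> {mpoly K[n]}) :
  ((msize (\prod_(i <- r | P i) q i)).-1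
     <= \sum_(i <- r | P i) (msize (q i)).-1)%N.
Proof.
apply: (big_rec2 (fun (p : {mpoly K[n]}) d => (msize p).-1 <= d)%N).
  by rewrite msize1.
move=> i p d _ le_d.
have [->|q0] := eqVneq (q i) 0; first by rewrite mul0r msize0.
have [->|p0] := eqVneq p 0; first by rewrite mulr0 msize0.
rewrite msizeM //.
have := q0; have := p0; rewrite -!msize_poly_eq0 -!lt0n => p1 q1.
by rewrite -(prednK p1) -(prednK q1) addSn addnS /= leq_add2l.
Qed.

(* Counting: the products of powers below [T + 1] of [k] polynomials of degree
   at most [e] lie in the span of the monomials of exponents at most [k T e],
   and [(T + 1) ^ k] exceeds [(k T e + 1) ^ m] for large [T] when [m < k]. *)
Lemma mpoly_algebraic_dependence {K : fieldType} {k m : nat}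
    (q : k.-tuple {mpoly K[m]}) :
  (m < k)%N -> exists2 u : {mpoly K[k]}, u != 0 & u \mPo q = 0.
Proof.
move=> mk; pose e := (\max_(i < k) msize (tnth q i))%N.
(* With this [T], [(k T e + 1) ^ m <= ((T + 1) (k e + 1)) ^ m = (T + 1) ^ m T < (T + 1) ^ k]. *)
pose T := ((k * e).+1 ^ m)%N.
pose rT := {ffun 'I_k -> 'I_T.+1}.
pose cT := {ffun 'I_m -> 'I_(k * (T * e)).+1}.
pose rmon (f : rT) := [multinom f i : nat | i < k].
pose cmon (f : cT) := [multinom f i : nat | i < m].
pose M : 'M[K]_(#|rT|, #|cT|) :=
  \matrix_(i, j) ('X_[rmon (enum_val i)] \mPo q)@_(cmon (enum_val j)).
have ltM : (\rank M < #|rT|)%N.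
  apply: leq_ltn_trans (rank_leq_col _) _.
  rewrite !card_ffun !card_ord.
  apply: (@leq_ltn_trans (T.+1 ^ m * T)).
    rewrite -expnMn; case: (posnP m) => [->//|m_gt0].
    by rewrite leq_exp2r // mulnCA ltn_mul.
  apply: (@leq_trans (T.+1 ^ m.+1)); last by rewrite leq_pexp2l.
  by rewrite expnSr ltn_pmul2l // expn_gt0.
have : kermx M != 0.
  by rewrite kermx_eq0 /row_free neq_ltn ltM.
case/rowV0Pn => u /sub_kermxP uM u0.
pose U : {mpoly K[k]} := \sum_i u 0 i *: 'X_[rmon (enum_val i)].
have rmon_inj : injective rmon.
  move=> f g /mnmP fg; apply/ffunP => i; apply: val_inj.
  by have := fg i; rewrite !mnmE.
exists U.
  apply: contra u0 => /eqP U0; apply/eqP/rowP => i; rewrite mxE.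
  have := congr1 (mcoeff (rmon (enum_val i))) U0.
  rewrite mcoeff0 raddf_sum /= (bigD1 i) //= big1 => [|j ji].
    by rewrite addr0 mcoeffZ mcoeffX eqxx mulr1.
  rewrite mcoeffZ mcoeffX.
  case: eqP => [/rmon_inj/enum_val_inj E|]; last by rewrite mulr0.
  by rewrite E eqxx in ji.
rewrite raddf_sum /=; apply/mpolyP => a; rewrite mcoeff0 raddf_sum /=.
(* Inside the box of exponents the coefficients are entries of [u *m M]; outside it they vanish by
   the degree bound. *)
have [/forallP sa|] := boolP [forall i, (a i < (k * (T * e)).+1)%N].
  have [f ->] : exists f, a = cmon f.
    exists [ffun i => Ordinal (sa i)]; apply/mnmP => i.
    by rewrite mnmE ffunE.
  have := congr1 (fun v : 'rV_ _ => v 0 (enum_rank f)) uM.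
  rewrite !mxE; apply: etrans; apply: eq_bigr => i _.
  by rewrite comp_mpolyZ mcoeffZ mxE enum_rankK.
rewrite negb_forall => /existsP[i]; rewrite -leqNgt => ai.
apply: big1 => j _; rewrite comp_mpolyZ mcoeffZ.
suff /eqP -> : ('X_[rmon (enum_val j)] \mPo q)@_a == 0 by rewrite mulr0.
rewrite mcoeff_eq0 comp_mpolyX; apply/negP => /msize_mdeg_lt.
rewrite ltnNge => /negP; apply.
have le_sz : ((msize (\prod_(i < k) tnth q i ^+ rmon (enum_val j) i)%R).-1
    <= k * (T * e))%N.
  apply: leq_trans (msize_prod_pred_leq _ _ _) _.
  rewrite -[X in (_ <= X * _)%N]card_ord -sum_nat_const; apply: leq_sum => l _.
  rewrite mnmE -[X in _ ^+ X]card_ord -prodr_const.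
  apply: leq_trans (msize_prod_pred_leq _ _ _) _.
  rewrite sum_nat_const card_ord leq_mul //; first by rewrite -ltnS.
  by apply: leq_trans (leq_pred _) _; apply: leq_bigmax.
apply: leq_trans (leqSpred _) _; apply: leq_trans (_ : a i <= _)%N.
  by apply: leq_trans ai.
by rewrite mdegE (bigD1 i) //= leq_addr.
Qed.

(** * Irreducible sets and chains *)

Lemma irreducible_vanish_mul {K : fieldType} {n : nat} {Z : set 'rV[K]_n}
    (f g : {mpoly K[n]}) :
  irreducible_set Z -> (forall x, Z x -> evalp (f * g) x = 0) ->
  (forall x, Z x -> evalp f x = 0) \/ (forall x, Z x -> evalp g x = 0).
Proof.
case=> _ _ irrZ fg0.
case: (irrZ (zero_locus [set f]%classic) (zero_locus [set g]%classic)).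
- by exists [set f]%classic.
- by exists [set g]%classic.
- move=> x /fg0 /eqP; rewrite /evalp mevalM mulf_eq0.
  by case/orP => /eqP h; [left|right] => _ ->.
- by move=> Zf; left => x /Zf; apply.
- by move=> Zg; right => x /Zg; apply.
Qed.

(** This yields one point where finitely many functions, none vanishing identically on [Z], are all
    nonzero. *)
Lemma irreducible_prod_neq0 {K : fieldType} {n : nat} {Z : set 'rV[K]_n}
    {I : Type} (r : seq I) (P : pred I) (f : I -> {mpoly K[n]}) :
  irreducible_set Z ->
  (forall i, P i -> exists2 x, Z x & evalp (f i) x != 0) ->
  exists2 x, Z x & evalp (\prod_(i <- r | P i) f i) x != 0.
Proof.
move=> irrZ fP.
apply: (big_ind (fun g => exists2 x, Z x & evalp g x != 0)) => //.
  by have [_ [x Zx] _] := irrZ; exists x; rewrite // /evalp meval1 oner_neq0.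
move=> g h [x Zx gx] [y Zy hy]; apply: contrapT => gh.
have [z Zz| g0 | h0] := irreducible_vanish_mul g h irrZ.
- by apply/eqP; apply: contrapT => /negP ?; apply: gh; exists z.
- by rewrite g0 ?eqxx in gx.
- by rewrite h0 ?eqxx in hy.
Qed.

(* Writing a relation as a polynomial in the last function, its constant term
   is a relation on the previous set of the chain; the rest is a multiple of
   the last function, which can be cancelled by irreducibility. *)
Lemma chain_algebraically_independent {K : fieldType} {n : nat} (m : nat)
    (Z : nat -> set 'rV[K]_n) (f : nat -> {mpoly K[n]}) :
  (forall i, (i <= m)%N -> irreducible_set (Z i)) ->
  (forall i, (i < m)%N -> (Z i `<=` Z i.+1)%classic) ->
  (forall i, (i < m)%N -> forall x, Z i x -> evalp (f i) x = 0) ->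
  (forall i, (i < m)%N -> exists2 x, Z i.+1 x & evalp (f i) x != 0) ->
  forall u : {mpoly K[m]},
    (forall x, Z m x -> u.@[fun i : 'I_m => evalp (f i) x] = 0) -> u = 0.
Proof.
elim: m => [|m IHm] irrZ subZ f0 fN u u0.
  have [_ [x Zx] _] := irrZ 0%N isT.
  have := u0 _ Zx; rewrite (nvar0_mpolyC u) mevalC => ->.
  by rewrite mpolyC0.
apply: muni0_eq0.
have {u0} : forall x, Z m.+1 x ->
    (map_poly (meval (fun i : 'I_m => evalp (f i) x)) (muni u)).[evalp (f m) x]
    = 0.
  by move=> x /u0; rewrite meval_muni.
elim/poly_ind: (muni u) => // p c IHp pc0.
have {}pc0 x : Z m.+1 x ->
    (map_poly (meval (fun i : 'I_m => evalp (f i) x)) p).[evalp (f m) x]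
      * evalp (f m) x + c.@[fun i : 'I_m => evalp (f i) x] = 0.
  by move=> /pc0; rewrite rmorphD rmorphM /= map_polyX map_polyC hornerMXaddC.
have c0 : c = 0.
  apply: IHm => [i im|i im|i im|i im|x Zx].
  - by apply: irrZ; apply: leqW.
  - by apply: subZ; apply: leqW.
  - by apply: f0; apply: leqW.
  - by apply: fN; apply: leqW.
  - have := pc0 x (subZ m (ltnSn m) x Zx).
    by rewrite (f0 m (ltnSn m) x Zx) mulr0 add0r.
rewrite c0 addr0; suff -> : p = 0 by rewrite mul0r.
apply: IHp.
(* Substituting the functions into [p] gives a polynomial [g] on the affine space, to which
   irreducibility of [Z m.+1] applies. *)
pose F := [tuple f i | i < m].
pose g := (map_poly (comp_mpoly F) p).[f m].
have gE x : evalp g x =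
    (map_poly (meval (fun i : 'I_m => evalp (f i) x)) p).[evalp (f m) x].
  rewrite /g /evalp -horner_map -map_poly_comp /=; congr _.[_].
  apply: eq_map_poly => a /=; rewrite comp_mpoly_meval.
  by apply: meval_eq => i; rewrite tnth_mktuple.
have [x Zx|g0|fm0] := irreducible_vanish_mul g (f m) (irrZ m.+1 (leqnn _)).
- rewrite /evalp mevalM -!/(evalp _ _) gE.
  by rewrite -[RHS](pc0 x Zx) c0 meval0 addr0.
- by move=> x Zx; rewrite -gE g0.
- by have [x Zx] := fN m (ltnSn m); rewrite fm0 ?eqxx.
Qed.

Lemma chain_length_leq {K : fieldType} {n : nat} (J : {set 'I_n}) (m : nat)
    (Z : nat -> set 'rV[K]_n) :
  (forall i, (i <= m)%N -> irreducible_set (Z i)) ->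
  (forall i, (i < m)%N -> (Z i `<` Z i.+1)%classic) ->
  (forall x, Z m x -> forall j, j \notin J -> x ord0 j = 0) ->
  (m <= #|J|)%N.
Proof.
move=> irrZ ltZ ZJ; rewrite leqNgt; apply/negP => Jm.
(* A point of [Z i.+1] outside [Z i] violates some equation of [Z i]. From [m] on, 0 is a
   placeholder. *)
have /choice[f fP] i : exists g : {mpoly K[n]}, (i < m)%N ->
    (forall x, Z i x -> evalp g x = 0) /\
    exists2 x, Z i.+1 x & evalp g x != 0.
  have [im|] := boolP (i < m)%N; last by exists 0.
  have [[I ZI] _ _] := irrZ i (ltnW im).
  have [_ /existsNP[x /not_implyP[Zx]]] := ltZ i im.
  rewrite ZI => /existsNP[g /not_implyP[Ig /eqP gx]].
  by exists g => _; split; [move=> y; apply | exists x].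
(* Restriction to the coordinate subspace: the sum is empty, hence 0, for [j] outside [J], and a
   single variable for [j] in [J]. *)
pose s := [tuple \sum_(l < #|J| | enum_val l == j) 'X_l | j < n]
  : n.-tuple {mpoly K[#|J|]}.
have sE (g : {mpoly K[n]}) x : Z m x ->
    (g \mPo s).@[fun l => x ord0 (enum_val l)] = evalp g x.
  move=> Zx; rewrite comp_mpoly_meval; apply: meval_eq => j.
  rewrite tnth_mktuple raddf_sum /=.
  have [jJ|jJ] := boolP (j \in J); last first.
    rewrite (ZJ x Zx j jJ) big1 // => l /eqP lj.
    by have := enum_valP l; rewrite lj (negbTE jJ).
  have [k <-] : exists k : 'I_#|J|, enum_val k = j.
    by exists (enum_rank_in jJ j); rewrite enum_rankK_in.
  rewrite (bigD1 k) //= mevalXU big1 ?addr0 // => l /andP[/eqP/enum_val_inj->].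
  by rewrite eqxx.
have [u u0 us] := mpoly_algebraic_dependence [tuple f i \mPo s | i < m] Jm.
case/eqP: u0; apply: (chain_algebraically_independent m Z f) => //.
- by move=> i /ltZ[].
- by move=> i /fP[].
- by move=> i /fP[].
move=> x Zx; have := congr1 (meval (fun l => x ord0 (enum_val l))) us.
rewrite comp_mpoly_meval meval0 => <-; apply: meval_eq => i.
by rewrite tnth_mktuple sE.
Qed.

(** * The Jacobian of a diagonal map *)

Lemma rank_Jac_diagonal {F K : fieldType} (iota : {rmorphism F -> K})
    {n R : nat} (d : nat) (A : 'M[F]_(R, n)) (x : 'rV[K]_n) (J : {set 'I_n}) :
  (d%:R : K) != 0 -> (forall j, j \in J -> x ord0 j != 0) ->
  (\rank (colsub (enum_val : 'I_#|J| -> 'I_n) A) <=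
   \rank (map_mx (fun f => evalp (map_mpoly iota f) x)
            (Jac (diagonal_map A d))))%N.
Proof.
move=> d0 xJ; set M := map_mx _ _.
have ME i j : M i j = iota (A i j) * (d%:R * x ord0 j ^+ d.-1).
  have derE l : mderiv j (A i l *: 'X_l ^+ d) =
      (A i l * (d * (l == j))%:R) *: 'X_l ^+ d.-1.
    rewrite mpolyXn mderivZ mderivX scalerA mulmnE mnm1E mulnC mpolyXn.
    have [->|_] := eqVneq l j; last by rewrite muln0 mulr0 !scale0r.
    congr (_ *: 'X_[_]); apply/mnmP => a.
    by rewrite mnmBE !mulmnE -[X in (_ - X)%N]muln1 -mulnBr subn1.
  rewrite !mxE /diagonal_map (raddf_sum (mderiv j)).
  rewrite (bigD1 j) //= big1 => [|l lj].
    rewrite addr0 derE eqxx muln1 /evalp.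
    rewrite map_mpolyZ mevalZ !rmorphXn /= map_mpolyX mevalXU.
    by rewrite rmorphM rmorph_nat mulrA.
  by rewrite derE (negbTE lj) muln0 mulr0 scale0r.
(* Scaling the selected columns by these nonzero factors is multiplication by an invertible matrix,
   which preserves the rank. *)
pose D := \row_l (d%:R * x ord0 (enum_val l) ^+ d.-1) : 'rV[K]_#|J|.
have Dfree : row_free (diag_mx D).
  rewrite row_free_unit unitmxE det_diag unitfE; apply/prodf_neq0 => l _.
  by rewrite mxE mulf_neq0 // expf_neq0 // xJ // enum_valP.
rewrite -(mxrank_map iota) -(mxrankMfree _ Dfree).
have -> : map_mx iota (colsub enum_val A) *m diag_mx D = colsub enum_val M.
  by apply/matrixP => i l; rewrite mul_mx_diag !mxE -ME !mxE.
by rewrite -[M in (\rank (colsub _ M) <= _)%N]mulmx1 -mulmx_colsub mxrankM_maxl.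
Qed.

Lemma Sstar_support_lt {F K : fieldType} (iota : {rmorphism F -> K})
    {n R : nat} (d : nat) (A : 'M[F]_(R, n)) (x : 'rV[K]_n) (J : {set 'I_n}) :
  (d%:R : K) != 0 -> non_degenerate A -> Sstar iota (diagonal_map A d) x ->
  (forall j, j \in J -> x ord0 j != 0) -> (#|J| < uphalf n)%N.
Proof.
move=> d0 ndA Sx xJ; rewrite ltnNge; apply/negP => leJ.
(* Non-degeneracy concerns exactly [uphalf n] columns, so [J] is cut down to that size. *)
have [B BJ cB] : exists2 B : {set 'I_n}, B \subset J & #|B| = uphalf n.
  exists [set j in take (uphalf n) (enum J)].
    by apply/fintype.subsetP => j; rewrite inE => /mem_take; rewrite mem_enum.
  rewrite cardsE (card_uniqP _) ?take_uniq ?enum_uniq //.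
  by rewrite size_takel // -cardE.
have := rank_Jac_diagonal iota d A x B d0
          (fun j jB => xJ j (fintype.subsetP BJ j jB)).
by rewrite (ndA B cB) leqNgt (Sx : is_true (_ < _)%N).
Qed.

(* (K, iota) ranges over the algebraic closures of 'F_p: K is algebraically
   closed and integralRange says that it is algebraic over the image of iota. *)
Theorem claim1 (p : nat) (p_prime : prime p)
    (K : closedFieldType) (iota : {rmorphism 'F_p -> K})
    (K_algebraic : integralRange iota)
    (n R d : nat) (n_ge1 : (1 <= n)%N) (R_ge1 : (1 <= R)%N)
    (d_ge1 : (1 <= d)%N) (d_lt_p : (d < p)%N)
    (A : 'M['F_p]_(R, n)) (A_nondeg : non_degenerate A) :
  (krull_dim (Sstar iota (diagonal_map A d)) <= (n%:R / 2)%:E)%E.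
Proof.
(* [K] has characteristic [p] through [iota], and [0 < d < p]. *)
have d0 : (d%:R : K) != 0.
  rewrite -(rmorph_nat iota) fmorph_eq0 -(dvdn_pcharf (pchar_Fp p_prime)).
  by rewrite gtnNdvd.
apply/krull_dimP => m [Z [irrZ ltZ]].
pose J := [set j | `[< exists2 x, Z m x & x ord0 j != 0 >]].
have ZJ x : Z m x -> forall j, j \notin J -> x ord0 j = 0.
  move=> Zx j; rewrite inE => /asboolPn jJ.
  by apply/eqP; apply: contrapT => /negP ?; apply: jJ; exists x.
have [irrZm ZS] := irrZ m (leqnn m).
have [j|x Zx] := irreducible_prod_neq0 (index_enum 'I_n) (mem J)
                   (fun j => 'X_j) irrZm.
  move=> jJ; have : j \in J by [].
  by rewrite inE => /asboolP[x Zx xj]; exists x; rewrite // /evalp mevalXU.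
rewrite /evalp rmorph_prod /= => /prodf_neq0 xJ.
have ltJ : (#|J| < uphalf n)%N.
  apply: (Sstar_support_lt iota d A x J) => //; first exact: ZS.
  by move=> j /xJ; rewrite mevalXU.
have leJ : (m <= #|J|)%N.
  by apply: (chain_length_leq J m Z) => // i /irrZ[].
(* [m < uphalf n] amounts to [2 m < n], slightly more than required. *)
rewrite lee_fin ler_pdivlMr // -natrM ler_nat.
by rewrite muln2 ltnW // -gtn_uphalf_double (leq_ltn_trans leJ).
Qed.
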